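(* Consider the closed-loop nonlinear differential-algebraic system (NDAE) $$E_d\dot{\check x}_d=(A_d+B_dK_d)\check x_d+G_d\,\check f_d(\check x_d,\check x_a),\qquad 0=A_a\check x_a+G_a\,\check f_a(\check x_d,\check x_a),$$ with $\check x_d\in\mathcal X_d\subseteq\mathbb R^{n_d}$, $\check x_a\in\mathcal X_a\subseteq\mathbb R^{n_a}$ and a feedback gain $K_d\in\mathbb R^{n_u\times n_d}$, as described in the context, and suppose Assumptions 1 and 2 of the context hold. Suppose there exist matrices $Q_1\in\mathbb R^{n_d\times n_d}$, $Q_2\in\mathbb R^{n_a\times n_d}$, $Q_3\in\mathbb R^{n_a\times n_a}$, with $Q_1$ and $Q_3$ nonsingular, and a scalar $\bar\epsilon>0$ such that $$\begin{bmatrix}\Upsilon & * & * & *\\ A_aQ_2 & Q_3^\top A_a^\top+A_aQ_3+\bar\epsilon\, G_aG_a^\top & * & *\\ \bar H_d^{1/2}Q_1 & O & -\bar\epsilon I & *\\ \bar H_a^{1/2}Q_2 & \bar H_a^{1/2}Q_3 & O & -\bar\epsilon I\end{bmatrix}\prec 0,$$ $$E_d^\top Q_1^{-1}=Q_1^{-\top}E_d\succ 0,$$ where $$\Upsilon:=Q_1^\top A_d^\top+A_dQ_1+Q_1^\top K_d^\top B_d^\top+B_dK_dQ_1+\bar\epsilon\, G_dG_d^\top,$$ $$\bar H_d:=(H_d^d)^\top H_d^d+(H_d^a)^\top H_d^a,\qquad \bar H_a:=(H_a^d)^\top H_a^d+(H_a^a)^\top H_a^a .$$ Then the closed-loop system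 is asymptotically stable around the origin, i.e. $\lim_{t\to\infty}\|\check x_d(t)\|_2=0$ and $\lim_{t\to\infty}\|\check x_a(t)\|_2=0$.
   Context: Setting. $E_d,A_d\in\mathbb R^{n_d\times n_d}$, $A_a\in\mathbb R^{n_a\times n_a}$, $G_d\in\mathbb R^{n_d\times n_{fd}}$, $G_a\in\mathbb R^{n_a\times n_{fa}}$, $B_d\in\mathbb R^{n_d\times n_u}$ are constant real matrices. The vectors $\check x_d=x_d-x_d^e$ and $\check x_a=x_a-x_a^e$ are the deviations of the dynamic and algebraic states from a fixed equilibrium $x^e=(x_d^e,x_a^e)$, and the nonlinearities are $\check f_d(\check x_d,\check x_a)=f_d(x_d,x_a)-f_d(x_d^e,x_a^e)\in\mathbb R^{n_{fd}}$ and $\check f_a(\check x_d,\check x_a)=f_a(x_d,x_a)-f_a(x_d^e,x_a^e)\in\mathbb R^{n_{fa}}$, regarded as functions on $\mathbb R^{n_d}\times\mathbb R^{n_a}$. The sets $\mathcal X_d$, $\mathcal X_a$ (operating regions) are assumed to contain the solution manifold of the NDAE, i.e. solutions $(\check x_d(t),\check x_a(t))$, $t\ge t_0$, take values in $\mathcal X_d\times\mathcal X_a$. Assumption 1. (i) $\check f_d$ and $\check f_a$ are smooth with $\check f_d(0,0)=0$, $\check f_a(0,0)=0$. (ii) There are known constant real matrices $H_d^d,H_d^a$ (with $n_d$ columns) and $H_a^d,H_a^a$ (with $n_a$ columns) such that for all $\check x_d\in\mathcal X_d$, $\check x_a\in\mathcal X_a$, $$\|\check f_d(\check x_d,\check x_a)\|_2^2\le\|H_d^d\check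 x_d\|_2^2+\|H_a^d\check x_a\|_2^2,\qquad \|\check f_a(\check x_d,\check x_a)\|_2^2\le\|H_d^a\check x_d\|_2^2+\|H_a^a\check x_a\|_2^2 .$$ Assumption 2 (index one). For all $\check x_d\in\mathcal X_d$, $\check x_a\in\mathcal X_a$, $\operatorname{rank}\!\left(A_a+G_a\,\dfrac{\partial\check f_a}{\partial\check x_a}(\check x_d,\check x_a)\right)=n_a$. Definition. The NDAE is called asymptotically stable (around the origin) if $\lim_{t\to\infty}\|\check x_d(t)\|_2=0$ and $\lim_{t\to\infty}\|\check x_a(t)\|_2=0$ along its solutions. Notation. $*$ denotes the entries determined by symmetry of a symmetric block matrix; $I$ and $O$ are identity and zero matrices of appropriate sizes; $\prec 0$ and $\succ 0$ mean (symmetric) negative and positive definite; $\bar H^{1/2}$ is the symmetric positive semidefinite square root; $Q^{-\top}=(Q^{-1})^\top$. *)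

(* Defs.v *)
(* Vectors of R^n are column vectors. *)
From HB Require Import structures.
From mathcomp Require Import all_boot all_order all_algebra.
From mathcomp Require Import all_classical all_reals all_analysis.
Set Implicit Arguments.
Unset Strict Implicit.
Unset Printing Implicit Defensive.
Import Order.TTheory GRing.Theory Num.Theory.
Import numFieldNormedType.Exports.
Local Open Scope classical_set_scope.
Local Open Scope ring_scope.

Section Matrices.
Context {R : realType}.

(* Euclidean norm; the library norm `|x| on matrices is the max norm. *)
Definition norm2 n (x : 'cV[R]_n) : R := Num.sqrt (\sum_i x i 0 ^+ 2).

Definition posdefmx n (M : 'M[R]_n) : Prop :=
  M^T = M /\ forall x : 'cV[R]_n, x != 0 -> 0 < (x^T *m M *m x) 0 0.

Definition negdefmx n (M : 'M[R]_n) : Prop := posdefmx (- M).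

Definition possemidefmx n (M : 'M[R]_n) : Prop :=
  M^T = M /\ forall x : 'cV[R]_n, 0 <= (x^T *m M *m x) 0 0.

(* The symmetric positive semidefinite square root; it exists and is unique
   when M is itself symmetric positive semidefinite (the default value 0 is
   only used for other M). *)
Definition sqrtmx n (M : 'M[R]_n) : 'M[R]_n :=
  xget 0 [set S : 'M[R]_n | possemidefmx S /\ S *m S = M].

(* The block matrix [A, *; B, D] with * determined by symmetry. *)
Definition symblock_mx m n (A : 'M[R]_m) (B : 'M[R]_(n, m)) (D : 'M[R]_n) :
  'M[R]_(m + n) := block_mx A B^T B D.

End Matrices.

(* C^oo: iterated directional derivatives of all orders exist and are
   continuous (vs = [::] is f itself). *)
Definition smooth (R : realType) (V W : normedModType R) (f : V -> W) : Prop :=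
  forall vs : seq V, let g := foldr (fun v h => 'D_v h) f vs in
    continuous g /\ forall x v, derivable g x v.

(* Jacobian with respect to the second variable; the library jacobian is for
   functions of row vectors and acts on the right. *)
Definition jacobian2 (R : realType) (m n p : nat)
    (f : 'cV[R]_m * 'cV[R]_n -> 'cV[R]_p) (x : 'cV[R]_m) (y : 'cV[R]_n) :
    'M[R]_(p, n) :=
  \matrix_(i, j) 'D_(delta_mx j 0) (fun z => f (x, z) i 0) y.

Section NDAE.
Context {R : realType} {nd na nfd nfa nu : nat}.
Variables (Ed Ad : 'M[R]_nd) (Bd : 'M[R]_(nd, nu)) (Kd : 'M[R]_(nu, nd)).
Variables (Gd : 'M[R]_(nd, nfd)) (Aa : 'M[R]_na) (Ga : 'M[R]_(na, nfa)).
Variables (fd : 'cV[R]_nd * 'cV[R]_na -> 'cV[R]_nfd).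
Variables (fa : 'cV[R]_nd * 'cV[R]_na -> 'cV[R]_nfa).
Variables (Xd : set 'cV[R]_nd) (Xa : set 'cV[R]_na).

Definition quadratically_bounded k l m
    (f : 'cV[R]_nd * 'cV[R]_na -> 'cV[R]_k)
    (Hd : 'M[R]_(l, nd)) (Ha : 'M[R]_(m, na)) : Prop :=
  forall xd xa, Xd xd -> Xa xa ->
    norm2 (f (xd, xa)) ^+ 2 <= norm2 (Hd *m xd) ^+ 2 + norm2 (Ha *m xa) ^+ 2.

Definition index_one : Prop :=
  forall xd xa, Xd xd -> Xa xa ->
    \rank (Aa + Ga *m jacobian2 fa xd xa) = na.

(* Solutions on [t0, +oo[ : at t0 only continuity of xd is required, and no
   regularity of xa is imposed. *)
Definition closed_loop_solution (t0 : R) (xd : R -> 'cV[R]_nd)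
    (xa : R -> 'cV[R]_na) : Prop :=
  [/\ {within `[t0, +oo[, continuous xd},
      (forall t, t0 < t -> derivable xd t 1 /\
        Ed *m (xd^`())%classic t = (Ad + Bd *m Kd) *m xd t + Gd *m fd (xd t, xa t)),
      (forall t, t0 <= t -> 0 = Aa *m xa t + Ga *m fa (xd t, xa t)) &
      (forall t, t0 <= t -> Xd (xd t) /\ Xa (xa t))].

Definition asymptotically_stable : Prop :=
  forall t0 xd xa, closed_loop_solution t0 xd xa ->
    (norm2 (xd t) @[t --> +oo] --> (0 : R)) /\
    (norm2 (xa t) @[t --> +oo] --> (0 : R)).

End NDAE.

(* Main.v *)
(* With y1 = Q1^-1 xd and y2 = Q3^-1 (xa - Q2 y1), that is (xd, xa) = Q (y1, y2),
   the function V = xd^T Ed^T Q1^-1 xd has derivative 2 y1^T Ed xd' along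
   solutions.  Adding 2 y2^T (Aa xa + Ga fa) = 0, Young's inequality for the
   nonlinear terms, their quadratic bounds and the matrix inequality give
   V' <= - c (|y1|^2 + |y2|^2) <= - k V, so xd decays exponentially.  The same
   inequality at y1 = 0, y2 = Q3^-1 xa bounds |xa| by a multiple of |xd|. *)
Require Import Defs.
From HB Require Import structures.
From mathcomp Require Import all_boot all_order all_algebra.
From mathcomp Require Import all_classical all_reals all_analysis.
From mathcomp Require Import complex ring lra.
Set Implicit Arguments.
Unset Strict Implicit.
Unset Printing Implicit Defensive.
Import Order.TTheory GRing.Theory Num.Theory.
Import numFieldNormedType.Exports.
Local Open Scope classical_set_scope.
Local Open Scope ring_scope.

(** * Euclidean inner product and its elementary inequalities *)

Section DotProduct.
Context {R : realType}.

Definition dotp n (x y : 'cV[R]_n) : R := \sum_i x i 0 * y i 0.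

Lemma dotpE n (x y : 'cV[R]_n) : dotp x y = (x^T *m y) 0 0.
Proof. by rewrite mxE; apply: eq_bigr => i _; rewrite mxE. Qed.

Lemma dotpC n (x y : 'cV[R]_n) : dotp x y = dotp y x.
Proof. by apply: eq_bigr => i _; rewrite mulrC. Qed.

Lemma dotpDr n (x y z : 'cV[R]_n) : dotp x (y + z) = dotp x y + dotp x z.
Proof. by rewrite !dotpE mulmxDr mxE. Qed.

Lemma dotpZr n a (x y : 'cV[R]_n) : dotp x (a *: y) = a * dotp x y.
Proof. by rewrite !dotpE -scalemxAr mxE. Qed.

Lemma dotpNr n (x y : 'cV[R]_n) : dotp x (- y) = - dotp x y.
Proof. by rewrite -scaleN1r dotpZr mulN1r. Qed.

Lemma dotp0r n (x : 'cV[R]_n) : dotp x 0 = 0.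
Proof. by rewrite dotpE mulmx0 mxE. Qed.

Lemma dotpDl n (x y z : 'cV[R]_n) : dotp (x + y) z = dotp x z + dotp y z.
Proof. by rewrite dotpC dotpDr !(dotpC z). Qed.

Lemma dotpZl n a (x y : 'cV[R]_n) : dotp (a *: x) y = a * dotp x y.
Proof. by rewrite dotpC dotpZr dotpC. Qed.

Lemma dotpNl n (x y : 'cV[R]_n) : dotp (- x) y = - dotp x y.
Proof. by rewrite dotpC dotpNr dotpC. Qed.

Lemma dotp0l n (x : 'cV[R]_n) : dotp 0 x = 0.
Proof. by rewrite dotpC dotp0r. Qed.

Lemma dotp_trmx m n (A : 'M[R]_(m, n)) x y : dotp (A^T *m x) y = dotp x (A *m y).
Proof. by rewrite !dotpE trmx_mul trmxK mulmxA. Qed.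

Lemma dotp_col_mx m n (x x' : 'cV[R]_m) (y y' : 'cV[R]_n) :
  dotp (col_mx x y) (col_mx x' y') = dotp x x' + dotp y y'.
Proof. by rewrite !dotpE tr_col_mx mul_row_col mxE. Qed.

Lemma dotpxx_ge0 n (x : 'cV[R]_n) : 0 <= dotp x x.
Proof. by apply: sumr_ge0 => i _; rewrite -expr2 sqr_ge0. Qed.

Lemma dotpxx_eq0 n (x : 'cV[R]_n) : dotp x x = 0 -> x = 0.
Proof.
move/eqP; rewrite psumr_eq0 => [/allP x0|i _]; last by rewrite -expr2 sqr_ge0.
apply/colP => i; rewrite mxE; apply/eqP; rewrite -sqrf_eq0 expr2.
by apply: x0; rewrite mem_index_enum.
Qed.

Lemma norm2E n (x : 'cV[R]_n) : norm2 x = Num.sqrt (dotp x x).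
Proof. by congr Num.sqrt; apply: eq_bigr => i _; rewrite expr2. Qed.

Lemma sqr_norm2 n (x : 'cV[R]_n) : norm2 x ^+ 2 = dotp x x.
Proof. by rewrite norm2E sqr_sqrtr// dotpxx_ge0. Qed.

(** Expand the square of [e *: x - y] and divide by [e]. *)
Lemma dotp_young n (e : R) (x y : 'cV[R]_n) : 0 < e ->
  2 * dotp x y <= e * dotp x x + e^-1 * dotp y y.
Proof.
move=> e0; have := dotpxx_ge0 (e *: x - y).
rewrite !(dotpDl, dotpDr, dotpNl, dotpNr, dotpZl, dotpZr) (dotpC y x) => h.
have -> : e * dotp x x + e^-1 * dotp y y = e^-1 * (e ^+ 2 * dotp x x + dotp y y).
  by field; rewrite gt_eqF.
rewrite ler_pdivlMl//; nra.
Qed.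

(** Cauchy-Schwarz on each row, with the squared Frobenius norm as constant; the added 1 keeps [C]
    positive even for [A = 0]. *)
Lemma mulmx_dotp_bounded m n (A : 'M[R]_(m, n)) :
  exists2 C, 0 < C & forall x : 'cV[R]_n, dotp (A *m x) (A *m x) <= C * dotp x x.
Proof.
exists (1 + \sum_i \sum_j A i j ^+ 2) => [|x].
  by rewrite ltr_wpDr// sumr_ge0// => i _; rewrite sumr_ge0// => j _; exact: sqr_ge0.
apply: (@le_trans _ _ ((\sum_i \sum_j A i j ^+ 2) * dotp x x)); last first.
  by rewrite ler_wpM2r ?dotpxx_ge0// lerDr.
rewrite mulr_suml; apply: ler_sum => i _.
rewrite mxE /dotp !big_distrlr/=.
(* Doubling and exchanging the two sums in one copy symmetrizes the bound in [j] and [k]. What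
   remains is termwise: the square of [A i j * x k 0 - A i k * x j 0] is nonnegative, as in
   Lagrange's identity. *)
rewrite -(ler_pM2l (ltr0n R 2)) !mulr_natl !mulr2n.
rewrite [X in _ <= X + _]exchange_big/= -!big_split/=; apply: ler_sum => j _.
rewrite -!big_split/=; apply: ler_sum => k _.
by have := sqr_ge0 (A i j * x k 0 - A i k * x j 0); nra.
Qed.

End DotProduct.

(** * Square roots and coercivity of definite matrices *)

Lemma poly_interpolation (F : fieldType) (f : F -> F) (s : seq F) :
  exists q : {poly F}, {in s, forall x, q.[x] = f x}.
Proof.
elim: s => [|a s [q qP]]; first by exists 0.
have [as_|as_] := boolP (a \in s).
  by exists q => x; rewrite inE => /orP[/eqP->|]; apply: qP.
pose r := \prod_(y <- s) ('X - y%:P) : {poly F}.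
have ra0 : r.[a] != 0 by rewrite -rootE root_prod_XsubC.
(* Newton interpolation: [r] vanishes at the earlier nodes, so the correction changes only the value
   at the new node [a]. *)
exists (q + ((f a - q.[a]) / r.[a]) *: r) => x; rewrite hornerD hornerZ inE.
move=> /orP[/eqP->|xs]; first by rewrite divfK// subrKC.
have /rootP-> : root r x by rewrite root_prod_XsubC.
by rewrite mulr0 addr0 qP.
Qed.

(** Transposition reverses products, but [M^T] commutes with its own polynomials. For symmetric [M]
    this makes every polynomial in [M] symmetric. *)
Lemma trmx_horner_mx (R : comNzRingType) n (M : 'M[R]_n.+1) (q : {poly R}) :
  (horner_mx M q)^T = horner_mx M^T q.
Proof.
elim/poly_ind: q => [|q c IH]; first by rewrite !rmorph0 trmx0.
rewrite !rmorphD !rmorphM/= !horner_mx_X !horner_mx_C linearD/= tr_scalar_mx.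
congr (_ + _); rewrite -!mulmxE trmx_mul IH.
by apply/esym/comm_horner_mx.
Qed.

Section DefiniteMatrices.
Context {R : realType}.

(* Diagonalizing [M] over [R[i]] gives a real polynomial [q] that takes
   the fourth root of each eigenvalue; then [q M ^+ 2] is the root. *)
Lemma exists_sqrtmx n (M : 'M[R]_n) : possemidefmx M ->
  exists S, possemidefmx S /\ S *m S = M.
Proof.
case: n M => [|n] M [Msym Mpos].
  by exists 0; split; [split; rewrite ?trmx0// => x; rewrite mulmx0 mul0mx mxE|
    apply/matrixP => -[]].
pose f : {rmorphism R -> R[i]} := real_complex R.
pose MC := map_mx f M.
have MCsym : MC \is symmetricmx.
  by apply/is_hermitianmxP; rewrite expr0 scale1r map_mx_id// map_trmx Msym.
have MCreal : MC \is a mxOver Num.real.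
  by apply/mxOverP => i j; rewrite mxE; apply/complex_realP; eexists.
have MCherm := realsym_hermsym MCsym MCreal.
have [P Pu [d /mxOverP dreal MCE]] : exists2 P, P \in unitmx &
    exists2 d, d \is a mxOver Num.real & MC = invmx P *m diag_mx d *m P.
  exists (spectralmx MC); first exact: spectral_unit.
  exists (spectral_diag MC); first exact: hermitian_spectral_diag_real.
  exact/orthomx_spectralP/hermitian_normalmx.
have [e dE] : exists e : 'rV[R]_n.+1, d = map_mx f e.
  exists (map_mx (@complex.Re R) d).
  by apply/rowP => i; rewrite !mxE/= -[LHS](RRe_real (dreal 0 i)).
(* Row [i] of [P] is a complex left eigenvector, nonzero because [P] is invertible. Being an
   eigenvalue descends to the real field, and a real eigenvector [v] then gives [e 0 i] times the
   squared length of [v] as a value of the nonnegative form of [M]. *)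
have e_ge0 i : 0 <= e 0 i.
  have : eigenvalue M (e 0 i).
    rewrite -(eigenvalue_map f) -/MC; apply/eigenvalueP.
    exists (row i P).
      rewrite -row_mul MCE !mulmxA mulmxV// mul1mx row_mul row_diag_mx.
      by rewrite dE -scalemxAl -rowE mxE.
    apply: contraTneq Pu => Pi0; rewrite unitmxE (expand_det_row _ i).
    rewrite big1 ?unitr0// => j _.
    by have /rowP/(_ j) := Pi0; rewrite !mxE => ->; rewrite mul0r.
  move=> /eigenvalueP[v vM v0].
  have := Mpos v^T; rewrite trmxK vM -scalemxAl mxE.
  have -> : (v *m v^T) 0 0 = dotp v^T v^T by rewrite dotpE trmxK.
  apply: contraTT; rewrite -!ltNge => e0; rewrite nmulr_rlt0//.
  rewrite lt_neqAle dotpxx_ge0 andbT eq_sym; apply: contra v0 => /eqP/dotpxx_eq0.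
  by move=> /(congr1 trmx); rewrite trmxK trmx0 => ->.
have [q qP] := poly_interpolation (fun x => Num.sqrt (Num.sqrt x))
  [seq e 0 i | i <- enum 'I_n.+1].
have q4e : map_mx (horner (map_poly f (q ^+ 4))) d = d.
  rewrite dE -map_mx_comp; apply/rowP => i; rewrite !mxE/= horner_map horner_exp.
  rewrite qP; last by apply/mapP; exists i; rewrite ?mem_enum.
  by rewrite (exprM _ 2 2) sqr_sqrtr ?sqrtr_ge0// sqr_sqrtr.
(* [q ^+ 4] fixes every eigenvalue, hence fixes the diagonal matrix and its conjugate; injectivity
   of the embedding into [R[i]] brings the identity back to real matrices. *)
have q4 : horner_mx M (q ^+ 4) = M.
  apply: (@map_mx_inj _ _ f); rewrite map_horner_mx -/MC [in LHS]MCE.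
  have /(horner_mx_uconjC (map_poly f (q ^+ 4)) (diag_mx d)) -> :
    P \is a GRing.unit by [].
  by rewrite horner_mx_diag q4e -MCE.
have tq : (horner_mx M q)^T = horner_mx M q by rewrite trmx_horner_mx Msym.
(* Fourth roots rather than square roots: the square of the symmetric matrix [horner_mx M q] is a
   Gram matrix, so its semidefiniteness is immediate. *)
exists (horner_mx M q *m horner_mx M q); split; first split.
- by rewrite trmx_mul tq.
- move=> x; rewrite -!mulmxA mulmxA -{1}tq -trmx_mul -dotpE dotpxx_ge0//.
- by rewrite -[RHS]q4 (_ : q ^+ 4 = (q * q) * (q * q)) ?rmorphM//; ring.
Qed.

Lemma sqrtmxP n (M : 'M[R]_n) : possemidefmx M ->
  possemidefmx (sqrtmx M) /\ sqrtmx M *m sqrtmx M = M.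
Proof.
move=> /exists_sqrtmx.
exact: (@xgetPex _ 0 [set S | possemidefmx S /\ S *m S = M]).
Qed.

Lemma possemidefmx_gram m p n (A : 'M[R]_(m, n)) (B : 'M[R]_(p, n)) :
  possemidefmx (A^T *m A + B^T *m B).
Proof.
split=> [|x]; first by rewrite linearD/= !trmx_mul !trmxK.
by rewrite -mulmxA -dotpE mulmxDl dotpDr -!mulmxA -!(dotpC (_^T *m _))
  !dotp_trmx addr_ge0// dotpxx_ge0.
Qed.

(** Translates the square-root blocks of the matrix inequality into the right-hand sides of the
    quadratic bounds on the nonlinearities. *)
Lemma dotp_sqrtmx_gram m p n (A : 'M[R]_(m, n)) (B : 'M[R]_(p, n)) x :
  let S := sqrtmx (A^T *m A + B^T *m B) in
  dotp (S *m x) (S *m x) = dotp (A *m x) (A *m x) + dotp (B *m x) (B *m x).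
Proof.
have [[Ssym _] SS] := sqrtmxP (possemidefmx_gram A B).
move=> S; rewrite -dotp_trmx Ssym mulmxA SS mulmxDl dotpDl -!mulmxA.
by rewrite !dotp_trmx.
Qed.

(** With [S] the square root of [M], the form is the squared length of [S *m x]. Definiteness makes
    [S] invertible, and a bound [C] for [invmx S] yields the constant [C^-1]. *)
Lemma posdefmx_coercive n (M : 'M[R]_n) : posdefmx M ->
  exists2 c, 0 < c & forall x, c * dotp x x <= dotp x (M *m x).
Proof.
move=> [Msym Mpos].
have Mpsd : possemidefmx M.
  split=> // x; have [->|/Mpos/ltW//] := eqVneq x 0.
  by rewrite mulmx0 mxE.
have [[Ssym _]] := sqrtmxP Mpsd; set S := sqrtmx M => SS.
have qE x : dotp x (M *m x) = dotp (S *m x) (S *m x).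
  by rewrite -SS -mulmxA -dotp_trmx Ssym.
have Su : S \in unitmx.
  rewrite -unitmx_tr -row_free_unit -kermx_eq0.
  apply/rowV0P => v /sub_kermxP vS; apply/eqP/negPn/negP => v0.
  have vT0 : v^T != 0 by apply: contra v0 => /eqP/(congr1 trmx); rewrite trmxK trmx0 => ->.
  have := Mpos _ vT0; rewrite -mulmxA -dotpE qE.
  by rewrite -(trmxK S) -trmx_mul vS trmx0 dotp0l ltxx.
have [C C0 CP] := mulmx_dotp_bounded (invmx S).
exists C^-1 => [|x]; first by rewrite invr_gt0.
by rewrite ler_pdivrMl// qE; have := CP (S *m x); rewrite mulKmx.
Qed.

End DefiniteMatrices.

(** * Derivatives of vector-valued functions and exponential decay *)

Section Calculus.
Context {R : realType}.

Lemma is_derive_coord m n (M : R -> 'M[R]_(m, n)) t i j : derivable M t 1 ->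
  is_derive t 1 (fun s => M s i j) ((M^`())%classic t i j).
Proof.
move=> dM; have /derivable_mxP/(_ i j) dMij := dM.
by rewrite derive1E (derive_mx dM) mxE; exact: derivableP.
Qed.

Lemma is_derive_dotp n (x y : R -> 'cV[R]_n) t :
  derivable x t 1 -> derivable y t 1 ->
  is_derive t 1 (fun s => dotp (x s) (y s))
    (dotp ((x^`())%classic t) (y t) + dotp (x t) ((y^`())%classic t)).
Proof.
move=> dx dy.
have -> : (fun s => dotp (x s) (y s)) =
    \sum_i ((fun s => x s i 0) * (fun s => y s i 0)).
  by apply/funext => s; rewrite fct_sumE.
rewrite -big_split/=; apply: is_derive_sum => i.
have xi := is_derive_coord i 0 dx; have yi := is_derive_coord i 0 dy.
apply: is_derive_eq; rewrite /GRing.scale/=; ring.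
Qed.

Lemma derivable_mulmx m n (M : 'M[R]_(m, n)) (x : R -> 'cV[R]_n) t :
  derivable x t 1 -> derivable (fun s => M *m x s) t 1.
Proof.
move=> dx; apply/derivable_mxP => i j.
have -> : (fun s => (M *m x s) i j) = \sum_k (fun s => M i k *: x s k j).
  by apply/funext => s; rewrite fct_sumE mxE.
apply: derivable_sum => k; apply: derivableZ.
by have /derivable_mxP := dx.
Qed.

Lemma derive1_mulmx m n (M : 'M[R]_(m, n)) (x : R -> 'cV[R]_n) t :
  derivable x t 1 ->
  ((fun s => M *m x s)^`())%classic t = M *m (x^`())%classic t.
Proof.
move=> dx; rewrite derive1E (derive_mx (derivable_mulmx (M := M) dx)).
apply/matrixP => i j; rewrite !mxE.
have -> : (fun s => (M *m x s) i j) = \sum_k (fun s => M i k *: x s k j).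
  by apply/funext => s; rewrite fct_sumE mxE.
have dxi k := is_derive_coord k j dx.
by rewrite derive_val.
Qed.

(** Gronwall: [V s * expR (k * s)] has nonpositive derivative. Starting at [t0 + 1] keeps the whole
    closed half-line inside the region [t0 < t] where [V] is differentiable. *)
Lemma exponential_decay (V : R -> R) (t0 k : R) : 0 < k ->
  (forall t, t0 < t -> derivable V t 1 /\ (V^`())%classic t <= - k * V t) ->
  forall t, t0 + 1 <= t -> V t <= V (t0 + 1) * expR (k * (t0 + 1)) * expR (- (k * t)).
Proof.
move=> k0 dV t t1.
pose g s := V s * expR (k * s).
have dg s : t0 < s ->
    is_derive s 1 g (((V^`())%classic s + k * V s) * expR (k * s)).
  move=> /dV[dVs _]; rewrite derive1E.
  have dVs' := derivableP dVs.
  have dE : is_derive s 1 (expR \o ( *%R k)) (expR (k * s) * k).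
    apply: is_derive1_comp.
    have -> : ( *%R k : R -> R) = k *: id by [].
    by apply: is_derive_eq; rewrite /GRing.scale/= mulr1.
  have -> : g = V * (expR \o ( *%R k)) by [].
  apply: is_derive_eq; rewrite /GRing.scale/=; ring.
have gle : g t <= g (t0 + 1).
  apply: (ler0_derive1_nincry (a := t0 + 1)) => // [s|s|].
  - by rewrite in_itv/= andbT => s1; have [] := dg s (ltac:(lra)).
  - rewrite in_itv/= andbT => s1.
    have s0 : t0 < s by lra.
    have dgs := dg s s0; rewrite derive1E derive_val.
    rewrite pmulr_lle0 ?expR_gt0//.
    by have [_] := dV s s0; lra.
  - apply: derivable_within_continuous => s; rewrite in_itv/= andbT => s1.
    by have [] := dg s (ltac:(lra)).
by rewrite expRN ler_pdivlMr ?expR_gt0.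
Qed.

Lemma norm2_cvg0 n (x : R -> 'cV[R]_n) (t1 C k : R) : 0 < k ->
  (forall t, t1 <= t -> dotp (x t) (x t) <= C * expR (- (k * t))) ->
  norm2 (x t) @[t --> +oo] --> (0 : R).
Proof.
move=> k0 xle.
have e0 : C * expR (- (k * t)) @[t --> +oo] --> (0 : R).
  rewrite -(mulr0 C); apply: cvgMr.
  apply: (cvg_comp (fun t => k * t) (fun t => expR (- t)) _ (@cvgr_expR R)).
  exact: gt0_cvgMry.
have d0 : dotp (x t) (x t) @[t --> +oo] --> (0 : R).
  apply: (squeeze_cvgr _ (cvg_cst 0) e0).
  by near=> t; rewrite dotpxx_ge0 xle.
rewrite -[X in _ --> X]sqrtr0.
under eq_fun do rewrite norm2E.
exact: (cvg_comp _ _ d0 (@sqrt_continuous R 0)).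
Unshelve. all: by end_near. Qed.

End Calculus.

(** * From the matrix inequality to a dissipation inequality *)

Section Dissipation.
Context {R : realType}.

Lemma dotp_symblock_mx m n (A : 'M[R]_m) (B : 'M[R]_(n, m)) (D : 'M[R]_n) u v :
  dotp (col_mx u v) (symblock_mx A B D *m col_mx u v) =
  dotp u (A *m u) + 2 * dotp v (B *m u) + dotp v (D *m v).
Proof.
rewrite /symblock_mx mul_block_col dotp_col_mx !dotpDr.
rewrite (dotpC u (B^T *m v)) dotp_trmx; ring.
Qed.

(* The test vector is [(y1, y2, eps^-1 Hd^{1/2} xd, eps^-1 Ha^{1/2} xa)], whose
   last two blocks maximize the quadratic form of the inequality; this plays
   the role of a Schur complement. *)
Lemma lmi_dissipation nd na nfd nfa kdd kad kda kaa
    (A : 'M[R]_nd) (Gd : 'M[R]_(nd, nfd)) (Aa : 'M[R]_na) (Ga : 'M[R]_(na, nfa))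
    (Hdd : 'M[R]_(kdd, nd)) (Had : 'M[R]_(kad, na))
    (Hda : 'M[R]_(kda, nd)) (Haa : 'M[R]_(kaa, na))
    (Q1 : 'M[R]_nd) (Q2 : 'M[R]_(na, nd)) (Q3 : 'M[R]_na) (eps : R) :
  let Hd := Hdd^T *m Hdd + Hda^T *m Hda in
  let Ha := Had^T *m Had + Haa^T *m Haa in
  0 < eps ->
  negdefmx
    (symblock_mx
      (symblock_mx
         (Q1^T *m A^T + A *m Q1 + eps *: (Gd *m Gd^T))
         (Aa *m Q2) (Q3^T *m Aa^T + Aa *m Q3 + eps *: (Ga *m Ga^T)))
      (block_mx (sqrtmx Hd *m Q1) 0 (sqrtmx Ha *m Q2) (sqrtmx Ha *m Q3))
      (symblock_mx (- eps%:M) 0 (- eps%:M))) ->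
  exists2 c, 0 < c & forall y1 y2 f g xd xa,
    xd = Q1 *m y1 -> xa = Q2 *m y1 + Q3 *m y2 ->
    2 * (dotp y1 (A *m xd + Gd *m f) + dotp y2 (Aa *m xa + Ga *m g)) <=
    - c * (dotp y1 y1 + dotp y2 y2)
    + eps^-1 * (dotp f f + dotp g g
        - (dotp (Hdd *m xd) (Hdd *m xd) + dotp (Had *m xa) (Had *m xa))
        - (dotp (Hda *m xd) (Hda *m xd) + dotp (Haa *m xa) (Haa *m xa))).
Proof.
move=> Hd Ha eps0 /posdefmx_coercive[c c0 lmi]; exists c => // y1 y2 f g xd xa xdE xaE.
pose sd := sqrtmx Hd *m xd; pose sa := sqrtmx Ha *m xa.
have := lmi (col_mx (col_mx y1 y2) (col_mx (eps^-1 *: sd) (eps^-1 *: sa))).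
rewrite mulNmx dotpNr !dotp_symblock_mx mul_block_col !dotp_col_mx.
rewrite !mulmxDl !mul0mx !addr0 dotp0r !mulNmx !mul_scalar_mx.
rewrite -!mulmxA -!scalemxAl -mulmxDr -xdE -xaE -/sd -/sa.
rewrite !(dotpDl, dotpDr, dotpNr, dotpZl, dotpZr).
have trE p q (B : 'M[R]_(p, q)) u v : dotp u (B^T *m v) = dotp v (B *m u).
  by rewrite dotpC dotp_trmx.
rewrite -!mulmxA !trE !dotp_trmx -xdE.
rewrite (dotp_sqrtmx_gram Hdd Hda xd) (dotp_sqrtmx_gram Had Haa xa).
have -> : dotp y2 (Aa *m xa) = dotp y2 (Aa *m (Q2 *m y1)) + dotp y2 (Aa *m (Q3 *m y2)).
  by rewrite xaE mulmxDr dotpDr.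
(* Young with weight [eps] bounds the cross terms with [f] and [g]; the parts quadratic in [y1] and
   [y2] are exactly the [eps *: (Gd *m Gd^T)] and [eps *: (Ga *m Ga^T)] terms of the diagonal
   blocks. *)
have := dotp_young (Gd^T *m y1) f eps0.
have := dotp_young (Ga^T *m y2) g eps0.
rewrite !dotp_trmx !(mulVKf (lt0r_neq0 eps0)).
have := dotpxx_ge0 (Hdd *m xd); have := dotpxx_ge0 (Hda *m xd).
have := dotpxx_ge0 (Had *m xa); have := dotpxx_ge0 (Haa *m xa).
move: (dotp (Hdd *m xd) _) (dotp (Hda *m xd) _) => hdd hda.
move: (dotp (Had *m xa) _) (dotp (Haa *m xa) _) => had haa.
move=> haa0 had0 hda0 hdd0.
(* Coercivity also controls the last two blocks of the test vector; this nonnegative surplus is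
   discarded. *)
have : 0 <= c * (eps^-1 * (eps^-1 * (hdd + hda)) + eps^-1 * (eps^-1 * (had + haa))).
  by rewrite !(mulr_ge0, addr_ge0)// ?invr_ge0 ltW.
move: (eps^-1) => ei; lra.
Qed.

End Dissipation.

(** * Lyapunov argument for the closed loop *)

Theorem theorem1 (R : realType) (nd na nfd nfa nu : nat) (kdd kad kda kaa : nat)
    (Ed Ad : 'M[R]_nd) (Bd : 'M[R]_(nd, nu)) (Kd : 'M[R]_(nu, nd))
    (Gd : 'M[R]_(nd, nfd)) (Aa : 'M[R]_na) (Ga : 'M[R]_(na, nfa))
    (fd : 'cV[R]_nd * 'cV[R]_na -> 'cV[R]_nfd)
    (fa : 'cV[R]_nd * 'cV[R]_na -> 'cV[R]_nfa)
    (Xd : set 'cV[R]_nd) (Xa : set 'cV[R]_na)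
    (Hdd : 'M[R]_(kdd, nd)) (Had : 'M[R]_(kad, na))
    (Hda : 'M[R]_(kda, nd)) (Haa : 'M[R]_(kaa, na))
    (fd_smooth : smooth fd) (fa_smooth : smooth fa)
    (fd0 : fd (0, 0) = 0) (fa0 : fa (0, 0) = 0)
    (fd_bound : quadratically_bounded Xd Xa fd Hdd Had)
    (fa_bound : quadratically_bounded Xd Xa fa Hda Haa)
    (index1 : index_one Aa Ga fa Xd Xa)
    (Q1 : 'M[R]_nd) (Q2 : 'M[R]_(na, nd)) (Q3 : 'M[R]_na) (eps : R)
    (Q1_nonsingular : Q1 \in unitmx) (Q3_nonsingular : Q3 \in unitmx)
    (eps_gt0 : 0 < eps) :
  let Upsilon := Q1^T *m Ad^T + Ad *m Q1 + Q1^T *m Kd^T *m Bd^T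
                 + Bd *m Kd *m Q1 + eps *: (Gd *m Gd^T) in
  let Hd := Hdd^T *m Hdd + Hda^T *m Hda in
  let Ha := Had^T *m Had + Haa^T *m Haa in
  negdefmx
    (symblock_mx
      (symblock_mx
         Upsilon
         (Aa *m Q2) (Q3^T *m Aa^T + Aa *m Q3 + eps *: (Ga *m Ga^T)))
      (block_mx (sqrtmx Hd *m Q1) 0
                (sqrtmx Ha *m Q2) (sqrtmx Ha *m Q3))
      (symblock_mx
         (- eps%:M)
         0 (- eps%:M))) ->
  Ed^T *m invmx Q1 = (invmx Q1)^T *m Ed ->
  posdefmx (Ed^T *m invmx Q1) ->
  asymptotically_stable Ed Ad Bd Kd Gd Aa Ga fd fa Xd Xa.
Proof.

move=> Upsilon Hd Ha lmi PE Ppos t0 xd xa [_ xd' xa' X].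
have [c c0 diss] : exists2 c, 0 < c & forall y1 y2 f g zd za,
    zd = Q1 *m y1 -> za = Q2 *m y1 + Q3 *m y2 ->
    2 * (dotp y1 ((Ad + Bd *m Kd) *m zd + Gd *m f) + dotp y2 (Aa *m za + Ga *m g))
    <= - c * (dotp y1 y1 + dotp y2 y2)
    + eps^-1 * (dotp f f + dotp g g
        - (dotp (Hdd *m zd) (Hdd *m zd) + dotp (Had *m za) (Had *m za))
        - (dotp (Hda *m zd) (Hda *m zd) + dotp (Haa *m za) (Haa *m za))).
  have UE : Upsilon = Q1^T *m (Ad + Bd *m Kd)^T + (Ad + Bd *m Kd) *m Q1
      + eps *: (Gd *m Gd^T).
    rewrite linearD/= trmx_mul mulmxDl mulmxDr mulmxA /Upsilon; congr (_ + _).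
    by rewrite [in RHS]addrACA addrA.
  move: lmi; rewrite UE => lmi.
  exact: (@lmi_dissipation R nd na nfd nfa kdd kad kda kaa
    _ _ _ _ Hdd Had Hda Haa Q1 Q2 Q3 eps eps_gt0 lmi).
pose y1 t := invmx Q1 *m xd t.
pose y2 t := invmx Q3 *m (xa t - Q2 *m y1 t).
have xdE t : xd t = Q1 *m y1 t by rewrite mulKVmx.
have xaE t : xa t = Q2 *m y1 t + Q3 *m y2 t by rewrite mulKVmx// subrKC.
have xdsol t : t0 <= t -> [/\
    dotp (fd (xd t, xa t)) (fd (xd t, xa t)) <=
      dotp (Hdd *m xd t) (Hdd *m xd t) + dotp (Had *m xa t) (Had *m xa t),
    dotp (fa (xd t, xa t)) (fa (xd t, xa t)) <=
      dotp (Hda *m xd t) (Hda *m xd t) + dotp (Haa *m xa t) (Haa *m xa t) &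
    Aa *m xa t + Ga *m fa (xd t, xa t) = 0].
  move=> t0t; have [Xdt Xat] := X t t0t.
  have := fd_bound _ _ Xdt Xat; have := fa_bound _ _ Xdt Xat.
  by rewrite !sqr_norm2 => gb fb; split=> //; rewrite -xa'.
have ei0 : 0 < eps^-1 by rewrite invr_gt0.
set P := Ed^T *m invmx Q1 in PE Ppos.
have [p p0 pP] := posdefmx_coercive Ppos.
have [C1 C10 C1P] := mulmx_dotp_bounded Q1.
have [C2 C20 C2P] := mulmx_dotp_bounded P.
have [C3 C30 C3P] := mulmx_dotp_bounded Q3.
have [C4 C40 C4P] := mulmx_dotp_bounded Hda.
pose V t := dotp (xd t) (P *m xd t).
(* The rate comes from bounding [2 * V t] by Young with weight 1, then by the constants [C2] of [P]
   and [C1] of [Q1], which gives [(1 + C2) * C1] times the squared length of [y1 t]. *)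
pose k := 2 * c / ((1 + C2) * C1).
have k0 : 0 < k by rewrite divr_gt0 ?mulr_gt0 ?addr_gt0.
have kV t : k * V t <= c * dotp (y1 t) (y1 t).
  have V2 : 2 * V t <= (1 + C2) * C1 * dotp (y1 t) (y1 t).
    have := dotp_young (xd t) (P *m xd t) ltr01; rewrite invr1 !mul1r.
    move/le_trans; apply; apply: (@le_trans _ _ ((1 + C2) * dotp (xd t) (xd t))).
      by rewrite mulrDl mul1r lerD2l.
    by rewrite -mulrA ler_wpM2l ?xdE ?C1P ?addr_ge0 ?(ltW C20).
  rewrite /k mulrAC ler_pdivrMr ?mulr_gt0 ?addr_gt0//.
  by have := ler_wpM2l (ltW c0) V2; lra.
have dV t : t0 < t -> derivable V t 1 /\ (V^`())%classic t <= - k * V t.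
  move=> t0t; have [dx xdt] := xd' t t0t.
  have [fdb fab alg] := xdsol t (ltW t0t).
  have iV := is_derive_dotp dx (derivable_mulmx (M := P) dx).
  split; first exact: ex_derive.
  rewrite derive1E derive_val derive1_mulmx//.
  have -> : dotp ((xd^`())%classic t) (P *m xd t) =
      dotp (y1 t) (Ed *m (xd^`())%classic t).
    by rewrite /P -mulmxA dotpC dotp_trmx.
  (* The symmetry [PE] makes the second half of the product rule equal to the first. *)
  have -> : dotp (xd t) (P *m (xd^`())%classic t) =
      dotp (y1 t) (Ed *m (xd^`())%classic t).
    by rewrite PE -mulmxA dotpC dotp_trmx dotpC.
  (* The algebraic equation removes the [y2] term on the left, and the quadratic bounds make the
     bracket behind [eps^-1] nonpositive. *)
  have := diss (y1 t) (y2 t) (fd (xd t, xa t)) (fa (xd t, xa t)) _ _ (xdE t) (xaE t).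
  rewrite alg dotp0r addr0 -xdt => h.
  have := dotpxx_ge0 (y2 t); have := kV t.
  by move: h fdb fab ei0 c0; move: (eps^-1) => ei; nra.
have V_le := exponential_decay k0 dV.
pose K := V (t0 + 1) * expR (k * (t0 + 1)).
have xd_le t : t0 + 1 <= t -> dotp (xd t) (xd t) <= p^-1 * K * expR (- (k * t)).
  move=> t1; rewrite -mulrA ler_pdivlMl//.
  exact: le_trans (pP _) (V_le t t1).
have xa_le t : t0 <= t -> dotp (xa t) (xa t) <=
    C3 * (c^-1 * (eps^-1 * C4)) * dotp (xd t) (xd t).
  move=> t0t; have [_ fab alg] := xdsol t t0t.
  pose w := invmx Q3 *m xa t.
  have wE : xa t = Q3 *m w by rewrite mulKVmx.
  (* The dynamic state of [diss] is set to 0 while [fa] keeps its value at the true [xd t], which is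
     possible because [g] is arbitrary there. The left side vanishes by the algebraic equation, and
     the bound on [fa] leaves only its [Hda *m xd t] part. *)
  have := diss 0 w 0 (fa (xd t, xa t)) 0 (xa t).
  rewrite alg !(mulmx0, addr0, add0r, dotp0r, mulr0) => /(_ erefl wE) h.
  rewrite {1 2}wE -!mulrA; apply: le_trans (C3P w) _; rewrite ler_pM2l//.
  rewrite ler_pdivlMl//.
  apply: (@le_trans _ _ (eps^-1 * dotp (Hda *m xd t) (Hda *m xd t))).
    have := dotpxx_ge0 (Had *m xa t).
    by move: h fab ei0; move: (eps^-1) => ei; nra.
  by rewrite ler_pM2l.
split; first exact: norm2_cvg0 k0 xd_le.
apply: (norm2_cvg0 (t1 := t0 + 1) (C := C3 * (c^-1 * (eps^-1 * C4)) * (p^-1 * K)) k0).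
move=> t t1; apply: le_trans (xa_le t _) _; first by rewrite (le_trans _ t1)// lerDl.
rewrite -[leRHS]mulrA ler_wpM2l ?xd_le//.
by rewrite !mulr_ge0 ?invr_ge0 1?ltW.
Qed.
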